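(* For any constant $\varepsilon>0$, there is a deterministic \textsf{CONGEST} algorithm that, on any $n$-vertex graph with maximum degree $\Delta$ whose vertices have unique $O(\log n)$-bit identifiers, computes a proper vertex coloring with $O(\Delta^{1+\varepsilon})$ colors in $O(\Delta^{1/2-\varepsilon/2})+\log^* n$ rounds.
   Context: The \textsf{CONGEST} model: synchronous rounds on the network graph, in each round every vertex may send one $O(\log n)$-bit message to each neighbor; vertices initially know their own identifier (and $\Delta$, $n$); at the end each vertex knows its own color. $\log^* n$ denotes the iterated logarithm. *)

(* Defs.v *)
From HB Require Import structures.
From mathcomp Require Import all_boot all_order all_algebra.
From mathcomp Require Import reals exp.
Set Implicit Arguments.
Unset Strict Implicit.
Unset Printing Implicit Defensive.
Import Order.TTheory GRing.Theory Num.Theory.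

Section Graphs.
Variables (V : finType) (e : rel V).

Definition max_degree : nat := \max_(v : V) #|[pred u | e v u]|.

(* [ports v] lists the neighbours of [v], each exactly once, in arbitrary
   order; the position of a neighbour in this list is its local port number. *)
Definition port_numbering (ports : V -> seq V) : Prop :=
  forall v, uniq (ports v) /\ forall u, (u \in ports v) = e v u.

(* The palette is {0, ..., q - 1}. *)
Definition proper_coloring (q : nat) (col : V -> nat) : Prop :=
  (forall v, col v < q) /\ (forall u v, e u v -> col u != col v).

End Graphs.

(* Identifiers are natural numbers written with at most b bits. *)
Definition unique_ids (V : finType) (b : nat) (id : V -> nat) : Prop :=
  injective id /\ forall v, id v < 2 ^ b.

(* All vertices run the same code. Initially a vertex knows only n, the maximum
   degree and its own identifier: [init n D i] is the initial state.
   [send s p] is the message that a vertex in state [s] sends through port [p];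
   the empty bit string plays the role of silence. [recv s ms] is the state
   after receiving the messages [ms], listed by increasing port number. Local
   computation is unrestricted, as usual in this model. *)
Record algorithm := Algorithm {
  state : Type;
  init : nat -> nat -> nat -> state;
  send : state -> nat -> bitseq;
  recv : state -> seq bitseq -> state;
  output : state -> nat
}.

Section Execution.
Variables (A : algorithm) (V : finType) (e : rel V).
Variables (ports : V -> seq V) (id : V -> nat).

Definition message (s : V -> state A) (u v : V) : bitseq :=
  send (s u) (index v (ports u)).

Fixpoint run (t : nat) : V -> state A :=
  if t is t'.+1 then
    fun v => recv (run t' v) [seq message (run t') u v | u <- ports v]
  else fun v => init A #|V| (max_degree e) (id v).

Definition bandwidth_le (T B : nat) : Prop :=
  forall t u v, t < T -> e u v -> size (message (run t) u v) <= B.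

Definition coloring_after (T : nat) (v : V) : nat := output (run T v).

End Execution.

Local Open Scope ring_scope.

Section LogStar.
Variable R : realType.

Definition log2 (x : R) : R := ln x / ln 2.

Fixpoint tower (i : nat) : nat := if i is j.+1 then (2 ^ tower j)%N else 1%N.

Lemma iter_log2_tower (i : nat) (x : R) :
  x <= (tower i)%:R -> iter i log2 x <= 1.
Proof.
elim: i x => [//|i IHi] x lex; rewrite iterSr; apply: IHi.
have ln2_gt0 : 0 < ln (2 : R) by rewrite ln_gt0 // ltr1n.
rewrite /log2 ler_pdivrMr //.
have [x0|x0] := ltP 0 x; last first.
  by rewrite ln0 // mulr_ge0 // ltW.
rewrite -mulr_natl mulr1 mulr_natl -lnXn ?ltr0n // -natrX ler_ln //.
by rewrite posrE ltr0n expn_gt0.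
Qed.

Lemma log_star_ex (n : nat) : exists i, iter i log2 n%:R <= 1.
Proof.
exists n; apply: iter_log2_tower; rewrite ler_nat.
by elim: n => [//|n IHn] /=; apply: leq_trans (ltn_expl _ _); rewrite ?ltnS.
Qed.

(* Least number of times log2 must be applied to n to get a value <= 1. *)
Definition log_star (n : nat) : nat := ex_minn (log_star_ex n).

End LogStar.

(* Main.v *)
Require Import Defs.
From HB Require Import structures.
From mathcomp Require Import all_boot all_order all_algebra.
From mathcomp Require Import reals exp.
From mathcomp Require Import all_field boolp.
From mathcomp Require Import zify ring lra.
Set Implicit Arguments.
Unset Strict Implicit.
Unset Printing Implicit Defensive.
Import Order.TTheory GRing.Theory Num.Theory.

(** Linial's algorithm, run for [log_star n] rounds from the identifiers, gives
    a colouring with polynomially many colours in the degree bound [d], and with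
    O(d^(1+eps)) colours directly when eps > 1. For eps = 1 one further
    reduction with polynomials of constant degree gives O(d^2) colours.

    For eps < 1 let [b] be about d^((1+eps)/2). A colour of the first phase
    selects a polynomial of constant degree over a field of about d/b elements.
    In round [x] an undecided vertex tries the value of its polynomial at [x] as
    its class and keeps it if at most [b] neighbours show the same value.
    Orienting an edge inside a class towards the endpoint that decided first, the
    outdegree is at most [b], and since two polynomials seldom agree everybody
    decides within O(d/b) rounds. The O(d/b) classes are then treated one after
    the other, in two rounds each, with the points (x, y) of a plane over a field
    of about [b] elements as palette, hence O(b^2) colours. A vertex owns a
    polynomial of constant degree, first picks a constant term for which few
    points of the resulting curve are used by neighbours of earlier classes, and
    then a free point of the curve that lies on no curve of an out-neighbour.

    The degree bound [d] is the maximum of the degree and a constant, which makes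
    all estimates uniform. *)

(** * Polynomial codes *)

Section PolynomialCode.
Local Open Scope ring_scope.
Variables (F : finFieldType) (k : nat).

Definition field_elem (x : nat) : F := nth 0 (enum F) x.

(* The zero tuple is removed so that every codeword is a nonconstant
   polynomial. *)
Definition nonzero_tuples : seq (k.-tuple F) :=
  rem [tuple of nseq k 0] (enum {:k.-tuple F}).

(** [c] selects the coefficients of degrees 1 to [k] and [s] the constant term: the curves of one
    colour are disjoint translates, and different colours in range stay different polynomials
    whatever the shifts. *)
Definition code_poly (c s : nat) : {poly F} :=
  (field_elem s)%:P
  + 'X * \poly_(i < k) (nth [tuple of nseq k 0] nonzero_tuples c)`_i.

Definition poly_code (c s x : nat) : nat :=
  enum_rank (code_poly c s).[field_elem x].

Lemma field_elem_inj x y :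
  (x < #|F|)%N -> (y < #|F|)%N -> field_elem x = field_elem y -> x = y.
Proof.
move=> xq yq /eqP; rewrite nth_uniq ?enum_uniq -?cardE //.
by move/eqP.
Qed.

Lemma count_field_elem (a : pred F) :
  count (a \o field_elem) (iota 0 #|F|) = count a (enum F).
Proof.
rewrite -count_map; congr (count a _).
by rewrite cardE -{2}(mkseq_nth 0 (enum F)).
Qed.

Lemma count_root (p : {poly F}) (m : nat) :
  p != 0 -> (size p <= m.+1)%N ->
  (count (root p \o field_elem) (iota 0 #|F|) <= m)%N.
Proof.
move=> p0 szp; rewrite count_field_elem -size_filter -ltnS.
apply: leq_trans szp; apply: max_poly_roots => //.
  exact: filter_all.
by rewrite filter_uniq ?enum_uniq.
Qed.

Lemma size_nonzero_tuples : size nonzero_tuples = (#|F| ^ k).-1.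
Proof. by rewrite size_rem ?mem_enum // -cardE card_tuple. Qed.

Lemma size_code_poly c s : (size (code_poly c s) <= k.+1)%N.
Proof.
apply: leq_trans (size_polyD _ _) _; rewrite geq_max size_polyC.
rewrite (leq_trans (leq_b1 _)) //=.
apply: leq_trans (size_polyMleq _ _) _; rewrite size_polyX /=.
by rewrite ltnS size_poly.
Qed.

Lemma coef_code_poly c s i : (i < k)%N ->
  (code_poly c s)`_i.+1 = (nth [tuple of nseq k 0] nonzero_tuples c)`_i.
Proof. by move=> ik; rewrite coefD coefC coefXM coef_poly ik add0r. Qed.

Lemma eq_tuple_nth (t t' : k.-tuple F) :
  (forall i, (i < k)%N -> t`_i = t'`_i) -> t = t'.
Proof.
move=> tt'; apply/val_inj/(@eq_from_nth _ 0); rewrite !size_tuple //.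
Qed.

(** The polynomials differ in a coefficient of positive degree, which no shift affects. The
    successors in the bounds account for the removed zero tuple. *)
Lemma code_poly_neq c c' s s' : c <> c' ->
  (c.+1 < #|F| ^ k)%N -> (c'.+1 < #|F| ^ k)%N ->
  code_poly c s != code_poly c' s'.
Proof.
move=> cc' cq c'q; apply/eqP => E; apply: cc'; apply/eqP.
rewrite -(@nth_uniq _ [tuple of nseq k 0] nonzero_tuples).
- apply/eqP/eq_tuple_nth => i ik.
  by rewrite -(coef_code_poly c s ik) E coef_code_poly.
- by rewrite size_nonzero_tuples -ltnS (ltn_predK cq).
- by rewrite size_nonzero_tuples -ltnS (ltn_predK cq).
- by rewrite rem_uniq ?enum_uniq.
Qed.

Lemma code_poly_nonconst c s b : (c.+1 < #|F| ^ k)%N ->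
  code_poly c s != b%:P.
Proof.
move=> cq; apply/eqP => E.
have: nth [tuple of nseq k 0] nonzero_tuples c \in nonzero_tuples.
  by rewrite mem_nth // size_nonzero_tuples -ltnS (ltn_predK cq).
rewrite mem_rem_uniq ?enum_uniq // inE => /andP[/eqP nz _]; apply: nz.
apply/eq_tuple_nth => i ik.
by rewrite -(coef_code_poly _ s ik) E coefC nth_nseq ik.
Qed.

Lemma poly_code_lt c s x : (poly_code c s x < #|F|)%N.
Proof. exact: ltn_ord. Qed.

(** Agreements are roots of the difference, a nonzero polynomial of degree at most [k]. *)
Lemma poly_code_agree c c' s s' : c <> c' ->
  (c.+1 < #|F| ^ k)%N -> (c'.+1 < #|F| ^ k)%N ->
  (count (fun x => poly_code c s x == poly_code c' s' x) (iota 0 #|F|) <= k)%N.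
Proof.
move=> cc' cq c'q; set p := code_poly c s - code_poly c' s'.
rewrite (@eq_count _ _ (root p \o field_elem)) => [|x].
  apply: count_root; first by rewrite subr_eq0 code_poly_neq.
  by rewrite (leq_trans (size_polyD _ _)) // size_polyN geq_max !size_code_poly.
by rewrite /= rootE hornerD hornerN subr_eq0 (inj_eq val_inj)
  (inj_eq enum_rank_inj).
Qed.

Lemma poly_code_value c s y : (c.+1 < #|F| ^ k)%N ->
  (count (fun x => poly_code c s x == y) (iota 0 #|F|) <= k)%N.
Proof.
move=> cq; have [yq|yq] := ltnP y #|F|; last first.
  rewrite (@eq_count _ _ pred0) ?count_pred0 // => x.
  by apply/eqP => xy; move: (poly_code_lt c s x); rewrite xy ltnNge yq.
set b := enum_val (Ordinal yq); set p := code_poly c s - b%:P.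
rewrite (@eq_count _ _ (root p \o field_elem)) => [|x].
  apply: count_root; first by rewrite subr_eq0 code_poly_nonconst.
  rewrite (leq_trans (size_polyD _ _)) // size_polyN geq_max size_code_poly.
  by rewrite size_polyC (leq_trans (leq_b1 _)).
rewrite /= rootE hornerD hornerN hornerC subr_eq0 -(inj_eq enum_rank_inj).
by rewrite enum_valK -(inj_eq val_inj).
Qed.

Lemma poly_code_shift_inj c s s' x : (s < #|F|)%N -> (s' < #|F|)%N ->
  poly_code c s x = poly_code c s' x -> s = s'.
Proof.
move=> sq s'q /val_inj /enum_rank_inj; rewrite !hornerD !hornerC.
by move=> /addIr; apply: field_elem_inj.
Qed.

End PolynomialCode.

(* Only fields of order a power of two are used: every bound has such a power
   within a factor two, so no information on gaps between primes is needed. *)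
Definition code_field (a : nat) : finFieldType :=
  s2val (pPrimePowerField (isT : prime 2) (ltn0Sn a)).

Lemma card_code_field a : #|code_field a| = 2 ^ a.+1.
Proof. exact: (s2valP' (pPrimePowerField (isT : prime 2) (ltn0Sn a))). Qed.

Definition code (a k : nat) : nat -> nat -> nat -> nat :=
  @poly_code (code_field a) k.

Section Code.
Variables a k : nat.
Local Notation q := (2 ^ a.+1).

Lemma code_lt c s x : code a k c s x < q.
Proof. by rewrite -card_code_field poly_code_lt. Qed.

Lemma code_agree c c' s s' : c <> c' -> c.+1 < q ^ k -> c'.+1 < q ^ k ->
  count (fun x => code a k c s x == code a k c' s' x) (iota 0 q) <= k.
Proof. by rewrite -card_code_field; apply: poly_code_agree. Qed.

Lemma code_value c s y : c.+1 < q ^ k ->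
  count (fun x => code a k c s x == y) (iota 0 q) <= k.
Proof. by rewrite -card_code_field; apply: poly_code_value. Qed.

Lemma code_shift_inj c s s' x : s < q -> s' < q ->
  code a k c s x = code a k c s' x -> s = s'.
Proof. by rewrite -card_code_field; apply: poly_code_shift_inj. Qed.

End Code.

(** * Broadcast programs *)

Fixpoint bits (w x : nat) : bitseq :=
  if w is w'.+1 then odd x :: bits w' x./2 else [::].

Definition nat_of_bits : bitseq -> nat := foldr (fun (b : bool) x => b + x.*2) 0.

Lemma size_bits w x : size (bits w x) = w.
Proof. by elim: w x => //= w IHw x; rewrite IHw. Qed.

Lemma bitsK w x : x < 2 ^ w -> nat_of_bits (bits w x) = x.
Proof.
elim: w x => [|w IHw] x /=; first by rewrite expn0 ltnS leqn0 => /eqP.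
move=> xw; rewrite IHw ?odd_double_half //.
by rewrite -ltn_double -[(2 ^ w).*2]mul2n -expnS (leq_ltn_trans _ xw) //
  -{2}(odd_double_half x) leq_addl.
Qed.

Record instr (S : Type) := Instr { imsg : S -> nat; iupd : S -> seq nat -> S }.

Section Programs.
Variables (S : Type) (V : finType) (ports : V -> seq V).
Implicit Types (ins : instr S) (p : seq (instr S)) (s : V -> S).

Definition step s ins : V -> S :=
  fun v => iupd ins (s v) [seq imsg ins (s u) | u <- ports v].

Definition exec p s : V -> S := foldl step s p.

Fixpoint msgs_lt (N : nat) p s : Prop :=
  if p is ins :: p' then (forall v,
    imsg ins (s v) < N) /\ msgs_lt N p' (step s ins)
  else True.

Lemma exec_cat p1 p2 s : exec (p1 ++ p2) s = exec p2 (exec p1 s).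
Proof. exact: foldl_cat. Qed.

Lemma msgs_lt_cat N p1 p2 s :
  msgs_lt N (p1 ++ p2) s <-> msgs_lt N p1 s /\ msgs_lt N p2 (exec p1 s).
Proof.
elim: p1 s => [|ins p1 IHp] s /=; first by split=> // -[].
by rewrite IHp; split=> [[? []]|[[]]].
Qed.

Lemma msgs_lt_leq N M p s : N <= M -> msgs_lt N p s -> msgs_lt M p s.
Proof.
move=> NM; elim: p s => //= ins p IHp s [HI Hp]; split; last exact: IHp.
by move=> v; apply: leq_trans NM.
Qed.

End Programs.

(** * Compilation of broadcast programs into algorithms *)

Section Compilation.
Variables (S : Type) (start : nat -> S) (out : S -> nat).
Variables (width : nat -> nat -> nat) (prog : nat -> nat -> seq (instr S)).

(** The state carries the rest of the program; as all vertices start from the same [n] and [D], they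
    stay in step without a clock. *)
Definition compiled : algorithm :=
  @Algorithm (nat * seq (instr S) * S)
    (fun n D i => (width n D, prog n D, start i))
    (fun st _ => let: (w, p, s) := st in
       if p is ins :: _ then bits w (imsg ins s) else [::])
    (fun st ms => let: (w, p, s) := st in
       if p is ins :: p' then (w, p', iupd ins s [seq nat_of_bits m | m <- ms])
       else st)
    (fun st => let: (_, _, s) := st in out s).

Variables (V : finType) (e : rel V) (ports : V -> seq V) (id : V -> nat).
Hypothesis portsP : port_numbering e ports.
Local Notation W := (width #|V| (max_degree e)).
Local Notation P := (prog #|V| (max_degree e)).

Lemma max_degree_le_pred_card : irreflexive e -> max_degree e <= #|V|.-1.
Proof.
move=> e_irr; apply/bigmax_leqP => u _; rewrite -(cardC1 u).
apply/subset_leq_card/subsetP => v; rewrite !inE.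
by apply: contraTneq => ->; rewrite e_irr.
Qed.

Lemma max_degree_gt0 u v : e u v -> 0 < max_degree e.
Proof.
move=> uv; apply: leq_trans (leq_bigmax u).
by apply/card_gt0P; exists v; rewrite inE.
Qed.

Lemma run_compiled t :
  (0 < max_degree e -> msgs_lt ports (2 ^ W) P (start \o id)) ->
  t <= size P ->
  forall v, run compiled e ports id t v
    = (W, drop t P, exec ports (take t P) (start \o id) v).
Proof.
move=> small; elim: t => [|t IHt] tP v; first by rewrite drop0 take0.
have ins0 : instr S by case: P tP => [|ins].
rewrite /= IHt 1?ltnW // (drop_nth ins0) //.
rewrite (take_nth ins0) // -cats1 exec_cat /=.
congr (_, _, _); rewrite /step; congr iupd.
rewrite -map_comp; apply/eq_in_map => u.
rewrite (portsP v).2 /= => vu.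
(* A decoded message came through a port, so there is an edge and the width bound applies. *)
have := small (max_degree_gt0 vu).
rewrite -{1}(cat_take_drop t P) msgs_lt_cat (drop_nth ins0) //= => -[_ [lt_u _]].
by rewrite /message IHt 1?ltnW // /= (drop_nth ins0) //= bitsK.
Qed.

Lemma compiled_bandwidth :
  (0 < max_degree e -> msgs_lt ports (2 ^ W) P (start \o id)) ->
  bandwidth_le compiled e ports id (size P) W.
Proof.
move=> small t u v tP uv; rewrite /message run_compiled ?(ltnW tP) //=.
have ins0 : instr S by case: P tP => [|ins].
by rewrite (drop_nth ins0) //= size_bits.
Qed.

End Compilation.

(** The message bound is guarded by [0 < D] because on a single vertex the width, a multiple of
    [up_log 2 n], is 0. *)
Definition solves (S : Type) (start : nat -> S) (out : S -> nat)
    (b w n D : nat) (p : seq (instr S)) (q : nat) : Prop :=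
  forall (V : finType) (e : rel V) (ports : V -> seq V) (id : V -> nat),
    symmetric e -> irreflexive e -> port_numbering e ports -> unique_ids b id ->
    #|V| = n -> max_degree e = D ->
    (0 < D -> msgs_lt ports (2 ^ w) p (start \o id)) /\
    proper_coloring e q (fun v => out (exec ports p (start \o id) v)).

Lemma algorithm_of_programs (S : Type) (start : nat -> S) (out : S -> nat)
    (c Cm : nat) (Q : nat -> nat -> nat -> nat -> Prop) :
  (forall n D, D <= n.-1 -> exists (p : seq (instr S)) (q : nat),
     solves start out (c * up_log 2 n) (Cm * up_log 2 n) n D p q
     /\ Q n D (size p) q) ->
  exists (A : algorithm) (rounds colors : nat -> nat -> nat),
  forall (V : finType) (e : rel V) (ports : V -> seq V) (id : V -> nat),
    symmetric e -> irreflexive e ->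
    port_numbering e ports ->
    unique_ids (c * up_log 2 #|V|)%N id ->
    let n := #|V| in
    let D := max_degree e in
    let T := rounds n D in
    let q := colors n D in
    [/\ bandwidth_le A e ports id T (Cm * up_log 2 n)%N,
        proper_coloring e q (coloring_after A e ports id T) & Q n D T q].
Proof.
move=> H.
(* Local computation is unrestricted, so the program of each pair may be fixed by choice; pairs with
   [D > n.-1] come from no graph and get a dummy. *)
have /choice[f fP] : forall nD : nat * nat, exists pq : seq (instr S) * nat,
  nD.2 <= nD.1.-1 ->
  solves start out (c * up_log 2 nD.1) (Cm * up_log 2 nD.1) nD.1 nD.2 pq.1 pq.2
     /\ Q nD.1 nD.2 (size pq.1) pq.2.
  move=> [n D]; case: (pselect (D <= n.-1)) => [nD|nD].
    by have [p [q pq]] := H n D nD; exists (p, q).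
  by exists ([::], 0).
pose width (n _ : nat) := Cm * up_log 2 n; pose prog n D := (f (n, D)).1.
exists (compiled start out width prog).
exists (fun n D => size (prog n D)), (fun n D => (f (n, D)).2).
move=> V e ports id es ei pP idP n D T q.
have [sol Qf] := fP (n, D) (max_degree_le_pred_card ei).
have [small [lt_q proper]] := sol V e ports id es ei pP idP erefl erefl.
have runE v : output (run (compiled start out width prog) e ports id T v)
    = out (exec ports (prog n D) (start \o id) v).
  by rewrite run_compiled //= take_oversize.
split=> //; first exact: compiled_bandwidth.
by split=> [v|u v uv]; rewrite /coloring_after !runE //; apply: proper.
Qed.

(** * Linial's colour reduction *)

Definition first_below (q : nat) (a : pred nat) : nat := find a (iota 0 q).

Lemma first_belowP q (a : pred nat) :
  count (predC a) (iota 0 q) < q -> first_below q a < q /\ a (first_below q a).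
Proof.
move=> few; have hasa : has a (iota 0 q).
  by rewrite has_count; have := count_predC a (iota 0 q); rewrite size_iota; lia.
have lt_q : first_below q a < q by rewrite -{2}(size_iota 0 q) -has_find.
by split=> //; have := nth_find 0 hasa; rewrite nth_iota.
Qed.

Lemma count_has_le (T : eqType) (b : T -> pred nat) (s : seq T) (r : seq nat) k :
  (forall m, m \in s -> count (b m) r <= k) ->
  count (fun x => has (b^~ x) s) r <= size s * k.
Proof.
elim: s => [|m s IHs] H /=; first by rewrite count_pred0.
rewrite mulSn; apply: leq_trans (_ : count (b m) r + count (fun x =>
  has (b^~ x) s) r <= _).
  rewrite -(count_predUI (b m) (fun x => has (b^~ x) s)).
  exact: leq_addr.
apply: leq_add; first by apply: H; rewrite mem_head.
by apply: IHs => m' m's; apply: H; rewrite inE m's orbT.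
Qed.

Lemma divmod_inj q x y x' y' : y < q -> y' < q ->
  x * q + y = x' * q + y' -> x = x' /\ y = y'.
Proof.
move=> yq y'q E; have q0 : 0 < q by lia.
have := congr1 (divn^~ q) E; have := congr1 (modn^~ q) E.
by rewrite /= !modnMDl !modn_small // !divnMDl // !divn_small // !addn0.
Qed.

Lemma leq_tower i : tower i <= tower i.+1.
Proof. by apply: ltnW; apply: ltn_expl. Qed.

Lemma tower_gt0 i : 0 < tower i.
Proof. by case: i => // i; rewrite expn_gt0. Qed.

(* [heard] holds the values shown by the neighbours, by port, in the round that
   fixed [class]; [used] holds the [final_code]s of the neighbours when the class
   of the vertex is treated. *)
Record node := Node {
  color : nat;
  class : option nat;
  heard : seq nat;
  used : seq nat;
  shift : nat;
  final : option nat
}.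

Definition fresh (c : nat) : node := Node c None [::] [::] 0 None.

Definition linial (a k : nat) : instr node :=
  let q := 2 ^ a.+1 in
  Instr color (fun s ms =>
    let f c := code a k c 0 in
    let x := first_below q (fun x => all (fun m => f m x != f (color s) x) ms) in
    fresh (x * q + f (color s) x)).

(* The index [i] counts the rounds that remain afterwards: the colours entering
   this round are below [maxn (tower i.+1) X ^ K]. *)
Definition linial_round (d K X i : nat) : instr node :=
  let l := K * maxn (tower i) X + 1 in linial (trunc_log 2 (d * l)) l.

Fixpoint linial_prog (d K X t : nat) : seq (instr node) :=
  if t is t'.+1 then linial_round d K X t' :: linial_prog d K X t' else [::].

Lemma size_linial_prog d K X t : size (linial_prog d K X t) = t.
Proof. by elim: t => //= t ->. Qed.

Section Linial.
Variables (V : finType) (e : rel V) (ports : V -> seq V).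
Hypothesis e_sym : symmetric e.
Hypothesis portsP : port_numbering e ports.
Implicit Type s : V -> node.

Lemma size_ports v : size (ports v) <= max_degree e.
Proof.
apply: leq_trans (leq_bigmax v); rewrite -(card_uniqP (portsP v).1).
by rewrite (@eq_card _ (mem (ports v)) (mem [pred u | e v u])) // => u;
  rewrite (portsP v).2.
Qed.

Lemma proper_coloringW q q' (col : V -> nat) :
  q <= q' -> proper_coloring e q col -> proper_coloring e q' col.
Proof. by move=> qq' [lt_q ?]; split=> // v; apply: leq_trans qq'. Qed.

(** Each neighbour agrees with [v] at no more than [k] of the [q] evaluation points, so some point
    separates [v] from all neighbours. The new colour packs this point with the value there; equal
    new colours on an edge would be an agreement at a separating point. *)
Lemma linial_step s m a k :
  proper_coloring e m (color \o s) -> m < (2 ^ a.+1) ^ k ->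
  max_degree e * k < 2 ^ a.+1 ->
  proper_coloring e ((2 ^ a.+1) ^ 2) (color \o step ports s (linial a k)) /\
  forall v, step ports s (linial a k) v
            = fresh (color (step ports s (linial a k) v)).
Proof.
set q := 2 ^ a.+1 => -[lt_m proper] mq Dq; split=> //.
pose f c := code a k c 0.
have codable u : (color (s u)).+1 < q ^ k by apply: leq_ltn_trans (lt_m u) mq.
pose good v x := all (fun m => f m x != f (color (s v)) x)
  [seq color (s u) | u <- ports v].
have goodP v : first_below q (good v) < q /\ good v (first_below q (good v)).
  apply: first_belowP.
  rewrite (@eq_count _ _ (fun x =>
    has (fun m => f m x == f (color (s v)) x) [seq color (s u) | u <- ports v])).
    apply: leq_ltn_trans Dq.
    have szD := size_ports v; apply: leq_trans (leq_mul szD (leqnn k)).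
    rewrite -(size_map (fun u => color (s u))).
    apply: (@count_has_le _ (fun m x => f m x == f (color (s v)) x)) =>
      _ /mapP[u vu ->].
    apply: code_agree => //.
    by apply/eqP; apply: proper; rewrite e_sym -(portsP v).2.
  by move=> x; rewrite /= -has_predC; apply: eq_has => m' /=; rewrite negbK.
have colE v : (color \o step ports s (linial a k)) v
    = first_below q (good v) * q + f (color (s v)) (first_below q (good v)) by [].
split=> [v|u v uv]; rewrite !colE.
  have [xq _] := goodP v;
    have := code_lt a k (color (s v)) 0 (first_below q (good v)).
  rewrite -/(f _ _) -/q; nia.
apply/eqP => /divmod_inj[]; try exact: code_lt.
have [_ /allP gv] := goodP v => -> E.
have /gv : color (s u) \in [seq color (s u) | u <- ports v].
  by apply: map_f; rewrite (portsP v).2 e_sym.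
by rewrite E eqxx.
Qed.

(** * The sequence of palettes in Linial's algorithm *)

Section Schedule.
Variables (d K X p : nat).
Hypothesis leDd : max_degree e <= d.
Hypothesis d_gt0 : 0 < d.
Hypothesis leKX : 16 * K ^ 2 <= X.
Hypothesis ledX : d ^ 2 <= X ^ p.
Hypothesis lepK : p + 3 <= K.

(** With [M] the maximum of [tower i] and [X], there are at most [(2 ^ M) ^ K < 2 ^ l] old colours,
    so polynomials of degree at most [l = K * M + 1] can code them over any field, in particular
    over one of order between [d * l] and [2 * d * l]. *)
Lemma linial_round_step s m i :
  proper_coloring e m (color \o s) -> m <= maxn (tower i.+1) X ^ K ->
  proper_coloring e (16 * K ^ 2 * d ^ 2 * maxn (tower i) X ^ 2)
    (color \o step ports s (linial_round d K X i)) /\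
  forall v, step ports s (linial_round d K X i) v
            = fresh (color (step ports s (linial_round d K X i) v)).
Proof.
move=> proper le_m; rewrite /linial_round.
set M := maxn (tower i) X; set l := K * M + 1; set a := trunc_log 2 (d * l).
have l0 : 0 < d * l by rewrite /l; nia.
have lq : d * l < 2 ^ a.+1 by apply: trunc_log_ltn.
have ql : 2 ^ a.+1 <= 2 * (d * l).
  by rewrite expnS leq_mul2l /= trunc_logP.
have [||prop fr] := @linial_step s m a l proper.
- apply: leq_ltn_trans le_m _.
  apply: (@leq_ltn_trans ((2 ^ M) ^ K)).
    rewrite leq_exp2r; last by lia.
    rewrite geq_max /= leq_exp2l // leq_maxl /=.
    apply: leq_trans (ltnW (ltn_expl X (isT : 1 < 2))) _.
    by rewrite leq_exp2l // leq_maxr.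
  apply: (@leq_trans (2 ^ l)); first by rewrite -expnM ltn_exp2l //
    /l mulnC addn1.
  by rewrite leq_exp2r ?(leq_trans _ (leq_pexp2l _ (ltn0Sn a))) // /l addn1.
- by apply: leq_ltn_trans lq; rewrite leq_mul2r leDd orbT.
- split=> //; apply: proper_coloringW prop.
  have M1 : 0 < M by rewrite leq_max tower_gt0.
  have lKM : l <= 2 * (K * M) by rewrite /l; nia.
  apply: (@leq_trans ((2 * (d * (2 * (K * M)))) ^ 2)).
    by rewrite leq_exp2r //; apply: leq_trans ql _; rewrite !leq_mul2l lKM !orbT.
  by rewrite !expnMn; lia.
Qed.

(** Closes the loop between consecutive rounds: the factors are at most [M], [M ^ p] and [M ^ 2],
    and [p + 3 <= K]. *)
Lemma linial_bound_le i :
  16 * K ^ 2 * d ^ 2 * maxn (tower i) X ^ 2 <= maxn (tower i) X ^ K.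
Proof.
set M := maxn _ _; have M1 : 0 < M by rewrite leq_max tower_gt0.
apply: leq_trans (leq_pexp2l M1 lepK).
apply: (@leq_trans (M * M ^ p * M ^ 2)); last first.
  by rewrite -expnS -expnD; apply: leq_pexp2l; lia.
rewrite leq_mul // leq_mul //; first by rewrite (leq_trans leKX) ?leq_maxr.
apply: leq_trans ledX _; have [->|p0] := posnP p; first by rewrite !expn0.
by rewrite leq_exp2r // leq_maxr.
Qed.

Lemma linial_phase t m N s :
  proper_coloring e m (color \o s) -> m <= maxn (tower t.+1) X ^ K ->
  m <= N -> maxn (tower t) X ^ K <= N ->
  [/\ msgs_lt ports N (linial_prog d K X t.+1) s,
      proper_coloring e (16 * K ^ 2 * d ^ 2 * X ^ 2)
        (color \o exec ports (linial_prog d K X t.+1) s)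
    & forall v, exec ports (linial_prog d K X t.+1) s v
        = fresh (color (exec ports (linial_prog d K X t.+1) s v))].
Proof.
have X1 : 0 < X by nia.
elim: t m s => [|t IHt] m s proper le_m mN MN.
  have [prop fr] := linial_round_step proper le_m.
  (* In the last round [tower 0 = 1], so the maximum is [X] and the final palette no longer depends
     on [n]. *)
  split=> //=; last by move: prop; rewrite /= (maxn_idPr X1).
  by split=> // v; apply: leq_trans (proper.1 v) mN.
have [prop fr] := linial_round_step proper le_m.
have [||||msgs prop' fr'] :=
  IHt (maxn (tower t.+1) X ^ K) (step ports s (linial_round d K X t.+1)).
- exact: proper_coloringW (linial_bound_le _) prop.
- by [].
- by [].
- apply: leq_trans MN; rewrite leq_exp2r; last by lia.
  by rewrite geq_max leq_maxr andbT leq_max leq_tower.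
by split=> //; split=> // v; apply: leq_trans (proper.1 v) mN.
Qed.

End Schedule.
End Linial.

(** * Classes of small outdegree *)

Lemma count_exchange (T T' : Type) (a : T -> T' -> bool) (r : seq T) (s :
  seq T') :
  \sum_(x <- r) count (a x) s = \sum_(u <- s) count (a^~ u) r.
Proof.
under eq_bigr do rewrite -sum1_count big_mkcond.
rewrite exchange_big; apply: eq_bigr => u _.
by rewrite -sum1_count [RHS]big_mkcond.
Qed.

Lemma leq_sum_in (T : eqType) (r : seq T) (F G : T -> nat) :
  (forall x, x \in r -> F x <= G x) -> \sum_(x <- r) F x <= \sum_(x <- r) G x.
Proof. by move=> FG; rewrite big_seq [X in _ <= X]big_seq; apply: leq_sum. Qed.

Definition trial (a k x : nat) (s : node) : nat :=
  if class s is Some y then y else code a k (color s) 0 x.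

Definition trial_round (a k b x : nat) : instr node :=
  Instr (trial a k x) (fun s ms =>
    let y := trial a k x s in
    if (class s == None) && (count_mem y ms <= b) then
      Node (color s) (Some y) ms (used s) (shift s) (final s)
    else s).

Definition trial_prog (a k b x : nat) : seq (instr node) :=
  [seq trial_round a k b i | i <- iota 0 x].

Section Trials.
Variables (V : finType) (e : rel V) (ports : V -> seq V).
Hypothesis e_sym : symmetric e.
Hypothesis portsP : port_numbering e ports.
Variables (a k b m : nat) (s : V -> node).
Local Notation q := (2 ^ a.+1).
Hypothesis s_fresh : forall v, s v = fresh (color (s v)).
Hypothesis proper : proper_coloring e m (color \o s).
Hypothesis le_m : m < q ^ k.

Let tr x := exec ports (trial_prog a k b x) s.

Let trS x v : tr x.+1 v = step ports (tr x) (trial_round a k b x) v.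
Proof.
by rewrite /tr /trial_prog -addn1 iotaD map_cat exec_cat.
Qed.

Let tr_shape x v : tr x v
  = Node (color (s v)) (class (tr x v)) (heard (tr x v)) [::] 0 None.
Proof.
elim: x => [|x IHx]; first by rewrite /tr /= s_fresh.
by rewrite trS /step /=; case: ifP => _; rewrite {1}IHx //= IHx.
Qed.

Let color_tr x v : color (tr x v) = color (s v).
Proof. by rewrite tr_shape. Qed.

Let tr_stable x x' v y : x <= x' -> class (tr x v) = Some y -> tr x' v = tr x v.
Proof.
move=> /subnKC <- xy; elim: (x' - x) => [|i IHi]; first by rewrite addn0.
by rewrite addnS trS /step /= IHi xy.
Qed.

Let tr_none x v : class (tr x.+1 v) = None -> class (tr x v) = None /\
  b < count (fun u => trial a k x (tr x u) == trial a k x (tr x v)) (ports v).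
Proof.
rewrite trS /step /=; case: ifP => //= /negbT; rewrite negb_and => + xN.
by rewrite xN eqxx /= -ltnNge count_map.
Qed.

(** [x0] is the round in which [v] decided; its state is frozen afterwards, so the stored values are
    those of that round. *)
Let tr_some x v y : class (tr x v) = Some y -> exists x0,
  let h u := trial a k x0 (tr x0 u) in
  [/\ y = h v, class (tr x0 v) = None, class (tr x0.+1 v) = Some y,
     heard (tr x v) = [seq h u | u <- ports v]
   & count (fun u => h u == y) (ports v) <= b].
Proof.
elim: x => [|x IHx]; first by rewrite /tr /= s_fresh.
have trSx := trS x v; move: (trSx); rewrite /step /=.
case: ifP => [/andP[/eqP xN few]|_] E.
  rewrite E /= => -[<-]; exists x; rewrite E; split=> //.
  by move: few; rewrite count_map.
by rewrite E; apply: IHx.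
Qed.

Let trial_lt x v : trial a k x (tr x v) < q.
Proof.
rewrite /trial; case E: (class _) => [y|]; last exact: code_lt.
have [x0 [-> x0N _ _ _]] := tr_some E.
by rewrite /trial x0N code_lt.
Qed.

Lemma trial_msgs_lt x : msgs_lt ports q (trial_prog a k b x) s.
Proof.
elim: x => [//|x IHx]; rewrite /trial_prog -[x.+1]addn1 iotaD map_cat msgs_lt_cat.
by split=> //; split=> // v; apply: trial_lt.
Qed.

(* A neighbour collides with [v] at most [k] times while it tries the values of
   its own polynomial and at most [k] times once its class is fixed. *)
Lemma trial_terminates v :
  max_degree e * (2 * k) < q * b.+1 -> class (tr q v) != None.
Proof.
apply: contraTneq => none; rewrite -leqNgt.
have noneW x : x <= q -> class (tr x v) = None.
  move=> xq; case E : (class (tr x v)) => [y|//].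
  by move: none; rewrite (tr_stable xq E) E.
pose hit x u := trial a k x (tr x u) == trial a k x (tr x v).
(* Double counting of pairs of a round and a colliding neighbour: an undecided [v] meets more than
   [b] collisions in every round. *)
have hits : q * b.+1 <= \sum_(x <- iota 0 q) count (hit x) (ports v).
  rewrite -{1}(size_iota 0 q) -sum1_size big_distrl /=.
  apply: leq_sum_in => x.
  rewrite mem_iota add0n mul1n => /andP[_ xq].
  by have [] := tr_none (noneW _ xq).
apply: leq_trans hits _; rewrite count_exchange.
have szD := size_ports portsP v; apply: leq_trans (leq_mul szD (leqnn _)).
rewrite -sum1_size big_distrl /=.
apply: leq_sum_in => u vu; rewrite mul1n.
have codable w : (color (s w)).+1 < q ^ k.
  by apply: leq_ltn_trans le_m; apply: proper.1.
have uv : color (s u) <> color (s v).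
  by apply/eqP; apply: proper.2; rewrite e_sym -(portsP v).2.
(* The class [u] ends up with. The default 0 is harmless: if [u] never decides, all collisions are
   between the two polynomials. *)
pose y := odflt 0 (class (tr q u)).
pose f c := code a k c 0.
apply: (@leq_trans (count (predU (fun x => f (color (s u)) x == f (color (s v)) x)
   (fun x => f (color (s v)) x == y)) (iota 0 q))).
  rewrite -!size_filter; apply: uniq_leq_size => [|x].
    by rewrite filter_uniq ?iota_uniq.
  rewrite !mem_filter mem_iota add0n => /andP[+ /andP[-> xq]]; rewrite xq !andbT.
  rewrite /hit /trial (noneW _ (ltnW xq)) !color_tr /=.
  case E : (class (tr x u)) => [z|]; last by move->.
  by rewrite /y (tr_stable (ltnW xq) E) E /= eq_sym => ->; rewrite orbT.
have /= := count_predUI (fun x => f (color (s u)) x == f (color (s v)) x)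
   (fun x => f (color (s v)) x == y) (iota 0 q).
have := code_agree 0 0 uv (codable u) (codable v).
have := code_value 0 y (codable v).
rewrite -/(f _); move: (count _ _) (count _ _) (count _ _) (count _ _) =>
  c1 c2 c3 c4.
lia.
Qed.

(** [h v u] is the value shown by [u] when [v] decides. If [u] has the same class and decided no
    later, it was then showing this class, so an edge inside a class is counted in the bound [b] of
    the later endpoint. *)
Lemma trial_phase : max_degree e * (2 * k) < q * b.+1 ->
  exists (y : V -> nat) (h : V -> V -> nat),
  [/\ forall v, exec ports (trial_prog a k b q) s v
        = Node (color (s v)) (Some (y v)) [seq h v u | u <- ports v] [::] 0 None,
      forall v, y v < q,
      forall v, count (fun u => h v u == y v) (ports v) <= b
    & forall u v, y u = y v -> h v u = y v \/ h u v = y u].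
Proof.
move=> Dq; pose y v := odflt 0 (class (tr q v)).
have classE v : class (tr q v) = Some (y v).
  by rewrite /y; case: (class _) (trial_terminates v Dq).
have /choice[t tP] := fun v => tr_some (classE v).
 pose h v u := trial a k (t v) (tr (t v) u).
exists y, h; split=> [v|v|v|u v].
- by rewrite -/(tr q) tr_shape classE; have [_ _ _ -> _] := tP v.
- have [-> xN _ _ _] := tP v; rewrite /trial xN; exact: code_lt.
- by have [_ _ _ _ ?] := tP v.
wlog: u v / t u <= t v => [W uv|tuv uv].
  have [/W|/ltnW/W] := leqP (t u) (t v); first exact.
  by move=> /(_ (esym uv)); case; [right|left].
have [yu uN uS _ _] := tP u; left; rewrite /h -uv.
have [E|/eqP tu] := eqVneq (t u) (t v); first by rewrite -E -yu.
have tuv' : t u < t v by rewrite ltn_neqAle tuv andbT; apply/eqP.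
by rewrite /trial (tr_stable tuv' uS) uS.
Qed.

End Trials.

(** * Colouring the classes *)

Definition point (a k c s x : nat) : nat := x * 2 ^ a.+1 + code a k c s x.

Definition blocked (a k c : nat) (us : seq nat) (s : nat) : nat :=
  count (fun x => (point a k c s x).+1 \in us) (iota 0 (2 ^ a.+1)).

(* The value 0 marks a vertex without a final colour. *)
Definition final_code (s : node) : nat := if final s is Some z then z.+1 else 0.

Definition shift_round (a k y : nat) : instr node :=
  Instr final_code (fun s ms =>
    if class s == Some y then
      let q := 2 ^ a.+1 in
      let sh := first_below q (fun sh =>
        blocked a k (color s) ms sh * q <= size ms) in
      Node (color s) (class s) (heard s) ms sh (final s)
    else s).

(** The message packs colour and shift, from which the receiver rebuilds the sender's curve. A heard
    value equal to [y] marks an out-neighbour; [zip] pairs it with the message from the same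
    port. *)
Definition place_round (a k y : nat) : instr node :=
  let q := 2 ^ a.+1 in
  Instr (fun s => color s * q + shift s) (fun s ms =>
    if class s == Some y then
      let f := code a k (color s) (shift s) in
      let x := first_below q (fun x =>
        ((point a k (color s) (shift s) x).+1 \notin used s) &&
        all (fun hm => (hm.1 == y) ==>
          (code a k (hm.2 %/ q) (hm.2 %% q) x != f x))
          (zip (heard s) ms)) in
      Node (color s) (class s) (heard s) (used s) (shift s)
        (Some (point a k (color s) (shift s) x))
    else s).

Fixpoint coloring_prog (a k j : nat) : seq (instr node) :=
  if j is j'.+1 then
    coloring_prog a k j' ++ [:: shift_round a k j'; place_round a k j']
  else [::].

Lemma size_coloring_prog a k j : size (coloring_prog a k j) = 2 * j.
Proof. by elim: j => //= j IHj; rewrite size_cat IHj /=; lia. Qed.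

Section Coloring.
Variables (V : finType) (e : rel V) (ports : V -> seq V).
Hypothesis e_sym : symmetric e.
Hypothesis portsP : port_numbering e ports.
Variables (a k b m r : nat) (s : V -> node).
Local Notation q := (2 ^ a.+1).
Variables (c y : V -> nat) (h : V -> V -> nat).
Hypothesis proper : proper_coloring e m c.
Hypothesis le_m : m < q ^ k.
Hypothesis s_def : forall v, s v
  = Node (c v) (Some (y v)) [seq h v u | u <- ports v] [::] 0 None.
Hypothesis y_lt : forall v, y v < r.
Hypothesis few_h : forall v, count (fun u => h v u == y v) (ports v) <= b.
Hypothesis orient : forall u v, y u = y v -> h v u = y v \/ h u v = y u.
Hypothesis q_big : max_degree e + b * k * q < q * q.

Let q_gt0 : 0 < q. Proof. by rewrite expn_gt0. Qed.

Lemma point_lt c' s' x : x < q -> point a k c' s' x < q ^ 2.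
Proof. by move=> xq; have := code_lt a k c' s' x; rewrite /point; nia. Qed.

Lemma point_inj c1 s1 x1 c2 s2 x2 : point a k c1 s1 x1 = point a k c2 s2 x2 ->
  x1 = x2 /\ code a k c1 s1 x1 = code a k c2 s2 x2.
Proof. by move=> /divmod_inj[]; rewrite ?code_lt. Qed.

(* The curves of the [q] shifts of one polynomial are disjoint, so some shift
   meets at most the average number of used points. *)
Lemma shift_exists c' us :
  let sh := first_below q (fun sh => blocked a k c' us sh * q <= size us) in
  sh < q /\ blocked a k c' us sh * q <= size us.
Proof.
apply: (@first_belowP q (fun sh => blocked a k c' us sh * q <= size us)).
rewrite ltnNge; apply/negP => all_bad.
have bad sh : sh < q -> size us < blocked a k c' us sh * q.
  move=> shq; have : all (predC (fun sh =>
    blocked a k c' us sh * q <= size us)) (iota 0 q).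
    rewrite all_count size_iota eqn_leq all_bad andbT.
    exact: leq_trans (count_size _ _) (eq_leq (size_iota 0 q)).
  by move=> /allP/(_ sh); rewrite mem_iota add0n shq /= -ltnNge; apply.
(* A used value comes from at most one pair of shift and abscissa: dividing its predecessor by [q]
   gives the abscissa, and there the ordinate determines the shift. *)
have total : \sum_(sh <- iota 0 q) blocked a k c' us sh <= size us.
  apply: (@leq_trans (\sum_(sh <- iota 0 q) \sum_(x <- iota 0 q)
    count (pred1 (point a k c' sh x).+1) us)).
    apply: leq_sum => sh _; rewrite /blocked -sum1_count big_mkcond.
    apply: leq_sum => x _; case: ifP => // xu.
    by rewrite -has_count has_pred1.
  under eq_bigr do rewrite count_exchange.
  rewrite exchange_big /= -sum1_size; apply: leq_sum => z _.
  rewrite (count_exchange (fun sh x => z == (point a k c' sh x).+1)).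
  have zx x sh : z = (point a k c' sh x).+1 -> x = z.-1 %/ q.
    by move=> ->; rewrite /point divnMDl // divn_small ?code_lt // addn0.
  apply: (@leq_trans (\sum_(x <- iota 0 q) (x == z.-1 %/ q))).
    apply: leq_sum_in => x; rewrite mem_iota add0n => /andP[_ xq].
    case: eqVneq => [_|nx]; last first.
      rewrite leqn0 -leqn0 leqNgt -has_count; apply/hasPn => sh _.
      by apply: contra nx => /eqP /zx ->.
    rewrite -size_filter; case E : (filter _ _) => [|s1 [|s2 l]] //.
    have : uniq [:: s1, s2 & l] by rewrite -E filter_uniq ?iota_uniq.
    have : {subset [:: s1; s2] <= filter (fun sh =>
      z == (point a k c' sh x).+1) (iota 0 q)}.
      by move=> w; rewrite E !inE => /orP[] ->; rewrite ?orbT.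
    move=> sub /= /andP[+ _]; rewrite inE negb_or => /andP[/eqP s12 _].
    have /sub : s1 \in [:: s1; s2] by rewrite mem_head.
    have /sub : s2 \in [:: s1; s2] by rewrite !inE eqxx orbT.
    rewrite !mem_filter !mem_iota !add0n =>
      /andP[/eqP-> s2q] /andP[/eqP[E12] s1q].
    by case: s12; apply: code_shift_inj s1q s2q (esym (point_inj E12).2).
  apply: (@leq_trans (count_mem (z.-1 %/ q) (iota 0 q))).
    by rewrite -sum1_count [X in _ <= X]big_mkcond; apply: leq_sum => x _ /=;
      case: eqP.
  by rewrite count_uniq_mem ?iota_uniq // leq_b1.
(* If every shift were bad, summing would give [q * (size us).+1 <= q * size us]. *)
have : \sum_(sh <- iota 0 q) (size us).+1
    <= \sum_(sh <- iota 0 q) blocked a k c' us sh * q.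
  by apply: leq_sum_in => sh; rewrite mem_iota add0n => shq; apply: bad.
rewrite -big_distrl /= big_const_seq count_predT size_iota iter_addn_0.
by move/leq_trans/(_ (leq_mul total (leqnn q))); rewrite leq_pmul2r // ltnn.
Qed.

Definition coloring_inv (j : nat) (p : V -> node) : Prop :=
  [/\ forall v, [/\ color (p v) = c v, class (p v) = Some (y v),
        heard (p v) = [seq h v u | u <- ports v] & shift (p v) < q],
      forall v, if y v < j then exists2 z, final (p v) = Some z & z < q ^ 2
                else final (p v) = None
    & forall u v, e u v -> y u < j -> y v < j -> final (p u) <> final (p v)].

(** A vertex of class [j] avoids the points held by neighbours of earlier classes and the curves of
    its out-neighbours; since every edge inside the class is oriented, one of its endpoints excludes
    a conflict. *)
Lemma coloring_step j p : coloring_inv j p ->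
  let p1 := step ports p (shift_round a k j) in
  coloring_inv j p1 /\ coloring_inv j.+1 (step ports p1 (place_round a k j)).
Proof.
move=> [shape fin prop] p1.
have class_eq v : (class (p v) == Some j) = (y v == j).
  by have [_ -> _ _] := shape v.
pose ms v := [seq final_code (p u) | u <- ports v].
have shape1 v : [/\ color (p1 v) = c v, class (p1 v) = Some (y v),
    heard (p1 v) = [seq h v u | u <- ports v] & shift (p1 v) < q].
  rewrite /p1 /step /= class_eq; case: eqP => [_|_] //=;
    have [-> -> -> _] := shape v.
  by split=> //; apply: (shift_exists _ _).1.
have fin1 v : final (p1 v) = final (p v).
  by rewrite /p1 /step /=; case: ifP.
have inv1 : coloring_inv j p1.
  by split=> // [v|u v]; rewrite !fin1; [apply: fin|apply: prop].
split=> //.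
have used1 v : y v = j ->
    used (p1 v) = ms v /\ blocked a k (c v) (ms v) (shift (p1 v)) * q <= size (ms v).
  move=> yv; rewrite /p1 /step /= class_eq yv eqxx /=; split=> //.
  have [-> _ _ _] := shape v; exact: (shift_exists (c v) (ms v)).2.
pose p2 := step ports p1 (place_round a k j); rewrite -/p2.
have class_eq1 v : (class (p1 v) == Some j) = (y v == j).
  by have [_ -> _ _] := shape1 v.
have shape2 v : [/\ color (p2 v) = c v, class (p2 v) = Some (y v),
    heard (p2 v) = [seq h v u | u <- ports v] & shift (p2 v) < q].
  by rewrite /p2 /step /=; have := shape1 v; case: ifP.
have old v : y v != j -> final (p2 v) = final (p v).
  by rewrite /p2 /step /= class_eq1 => /negbTE->.
pose pt v x := point a k (c v) (shift (p1 v)) x.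
have new v : y v = j -> exists x, [/\ final (p2 v) = Some (pt v x), x < q,
    (pt v x).+1 \notin ms v
    & forall u, u \in ports v -> h v u = j ->
        code a k (c u) (shift (p1 u)) x != code a k (c v) (shift (p1 v)) x].
  move=> yv; rewrite /p2 /step /= class_eq1 yv eqxx /=.
  have [-> _ -> _] := shape1 v; have [-> few] := used1 v yv.
  rewrite zip_map; set good := (X in first_below q X).
  suff [xq /andP[unused ok]] :
    first_below q good < q /\ good (first_below q good).
    exists (first_below q good); split=> // u vu hj.
    have [cu _ _ shu] := shape1 u.
    move: ok => /allP/(_ (h v u, color (p1 u) * q + shift (p1 u))).
    rewrite (map_f (fun u => (h v u, color (p1 u) * q + shift (p1 u))) vu).
    by rewrite /= hj eqxx divnMDl // modnMDl divn_small // modn_small //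
      addn0 cu; apply.
  apply: first_belowP.
  pose nb := [seq u <- ports v | h v u == j].
  pose clash u x := code a k (c u) (shift (p1 u)) x == code a k (c v) (shift (p1 v)) x.
  (* Used points spoil at most [D / q] abscissas and each of the at most [b] out-neighbours at most
     [k]; [q_big] keeps the total below [q]. *)
  apply: (@leq_ltn_trans (blocked a k (c v) (ms v) (shift (p1 v)) + b * k));
    last first.
    have : size (ms v) <= max_degree e by rewrite size_map; apply: size_ports.
    move: few q_big; move: (blocked _ _ _ _ _) (size _) (max_degree e) => B sz D.
    move: q_gt0 (b * k); move: (q) => Q Q0 bk ? ? ?.
    rewrite -(@ltn_pmul2r Q) //; nia.
  apply: (@leq_trans (count (predU (fun x => (pt v x).+1 \in ms v)
      (fun x => has (clash^~ x) nb)) (iota 0 q))).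
    apply: sub_count => x; rewrite /= /good negb_and negbK => /orP[->//|bad].
    apply/orP; right; move: bad; rewrite -has_predC has_map => /hasP[u vu].
    rewrite /= negb_imply negbK => /andP[hj].
    have [-> _ _ shu] := shape1 u.
    rewrite divnMDl // modnMDl divn_small // modn_small // addn0 => cl.
    by apply/hasP; exists u; rewrite // mem_filter hj.
  have := count_predUI (fun x => (pt v x).+1 \in ms v) (fun x =>
    has (clash^~ x) nb) (iota 0 q).
  move=> E; apply: leq_trans (leq_trans (leq_addr _ _) (eq_leq E)) _.
  apply: leq_add => //.
  apply: (@leq_trans (size nb * k)); last first.
    by rewrite leq_mul // size_filter -yv few_h.
  apply: count_has_le => u; rewrite mem_filter => /andP[_ vu].
  apply: code_agree; last 2 first.
  - by apply: leq_ltn_trans le_m; apply: proper.1.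
  - by apply: leq_ltn_trans le_m; apply: proper.1.
  - by apply/eqP; apply: proper.2; rewrite e_sym -(portsP v).2.
have new_old u v : e u v -> y u < j -> y v = j -> final (p2 u) <> final (p2 v).
  move=> uv yu yv; rewrite old; last by rewrite neq_ltn yu.
  have [x [-> _ unused _]] := new v yv.
  have := fin u; rewrite yu => -[z zE _]; rewrite zE => -[zx].
  case/negP: unused; apply/mapP; exists u; first by rewrite (portsP v).2 e_sym.
  by rewrite /final_code zE zx.
(* A common final point would lie on both curves at one abscissa. The shift of [u] was fixed a round
   earlier, so [v] knew the curve and excluded that abscissa. *)
have new_new u v : e u v -> y u = j -> y v = j -> h v u = j ->
    final (p2 u) <> final (p2 v).
  move=> uv yu yv hj; have [x [-> _ _ _]] := new u yu.
  have [x' [-> _ _ ok]] := new v yv => -[] /point_inj[xx' codes].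
  have vu : u \in ports v by rewrite (portsP v).2 e_sym.
  by have := ok u vu hj; rewrite -xx' codes xx' eqxx.
split=> // [v|u v uv].
  have [yv|yv] := eqVneq (y v) j.
    by rewrite yv ltnSn; have [x [-> xq _ _]] := new v yv; exists (pt v x) =>
      //; apply: point_lt.
  by rewrite old // ltnS leq_eqVlt (negbTE yv) /=; apply: fin.
rewrite ltnS leq_eqVlt => /predU1P[yu|yu];
  rewrite ltnS leq_eqVlt => /predU1P[yv|yv].
- have [|hj|hj] := @orient u v; first by rewrite yu.
    by apply: new_new => //; rewrite hj.
  by move=> /esym; apply: new_new; rewrite ?hj // e_sym.
- by move=> /esym; apply: new_old; rewrite // e_sym.
- exact: new_old.
- by rewrite !old ?neq_ltn ?yu ?yv //; apply: prop.
Qed.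

Lemma coloring_inv_exec N j : q ^ 2 < N -> m * q <= N ->
  msgs_lt ports N (coloring_prog a k j) s /\
  coloring_inv j (exec ports (coloring_prog a k j) s).
Proof.
move=> qN mN; elim: j => [|j [IHm IHj]].
  by split=> //; split=> // v; rewrite /= s_def.
rewrite /= msgs_lt_cat exec_cat /=; set p := exec _ _ _ in IHj *.
have [inv1 inv2] := coloring_step IHj; do !split=> //.
  (* Final codes are offset by one and may equal [q ^ 2], hence the strict bound by [N]. *)
  move=> v; rewrite /final_code; have [_ /(_ v) + _] := IHj.
  by case: ifP => _ => [[z ->] zq|->]; apply: leq_ltn_trans qN.
move=> v; apply: leq_trans mN; have [/(_ v)[-> _ _ shq] _ _] := inv1.
apply: (@leq_trans ((c v).+1 * q)); first by rewrite mulSn addnC ltn_add2r.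
by rewrite leq_mul2r (proper.1 v) orbT.
Qed.

Lemma coloring_phase N : q ^ 2 < N -> m * q <= N ->
  msgs_lt ports N (coloring_prog a k r) s /\
  proper_coloring e (q ^ 2)
    (fun v => odflt 0 (final (exec ports (coloring_prog a k r) s v))).
Proof.
move=> qN mN; have [? [_ fin prop]] := coloring_inv_exec r qN mN; split=> //.
split=> [v|u v uv]; first by have := fin v; rewrite y_lt => -[z ->].
have := prop u v uv (y_lt u) (y_lt v).
have := fin u; have := fin v; rewrite !y_lt => -[z -> _] [z' -> _] /= zz.
by apply/eqP => E; apply: zz; rewrite E.
Qed.

End Coloring.

(** * Combining the phases *)

Lemma pow2_between C : 0 < C ->
  C < 2 ^ (trunc_log 2 C).+1 /\ 2 ^ (trunc_log 2 C).+1 <= 2 * C.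
Proof.
by move=> C0; rewrite trunc_log_ltn // expnS leq_mul2l trunc_logP.
Qed.

(** This supplies [q_big]: as [D <= b ^ 2 <= b * k * q], the left side is at most
    [2 * k * b * q]. *)
Lemma room_for_point D d b k q :
  D <= d -> d <= b ^ 2 -> 0 < k -> 2 * k * b < q -> D + b * k * q < q * q.
Proof.
move=> leDd ledb k0 lq; have leb : b <= b * k by rewrite leq_pmulr.
have leq' : b <= q by apply: leq_trans (ltnW lq); rewrite leq_pmull // muln_gt0.
apply: (@leq_ltn_trans (b * k * q + b * k * q)).
  by rewrite leq_add2r (leq_trans leDd) // (leq_trans ledb) // leq_mul.
by rewrite -mulnDl ltn_pmul2r; lia.
Qed.

Section FromIdentifiers.
Variables (c K p d X n D t w N : nat).
Hypothesis leDd : D <= d.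
Hypothesis d_gt0 : 0 < d.
Hypothesis leKX : 16 * K ^ 2 <= X.
Hypothesis ledX : d ^ 2 <= X ^ p.
Hypothesis lecK : c + p + 3 <= K.
Hypothesis le_n_tower : n <= tower t.+1.
Hypothesis le_tower_n : tower t <= maxn n 1.
Hypothesis leidN : 2 ^ (c * up_log 2 n) <= N.
Hypothesis leXN : maxn n X ^ K <= N.

(** Identifiers form a proper colouring. [tower t.+1] is a power of two not below [n], so it is at
    least [2 ^ up_log 2 n], and identifiers are below [tower t.+1 ^ c] with [c <= K], where the
    schedule starts. *)
Lemma linial_from_ids (V : finType) (e : rel V) (ports : V -> seq V) (id :
  V -> nat) :
  symmetric e -> irreflexive e -> port_numbering e ports ->
  unique_ids (c * up_log 2 n) id -> max_degree e = D ->
  [/\ msgs_lt ports N (linial_prog d K X t.+1) (fresh \o id),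
      proper_coloring e (16 * K ^ 2 * d ^ 2 * X ^ 2)
        (color \o exec ports (linial_prog d K X t.+1) (fresh \o id))
    & forall v, exec ports (linial_prog d K X t.+1) (fresh \o id) v
        = fresh (color (exec ports (linial_prog d K X t.+1) (fresh \o id) v))].
Proof.
move=> es ei pP [id_inj id_lt] eD.
have K0 : 0 < K by lia.
have X0 : 0 < X by nia.
apply: (@linial_phase _ _ _ es pP d K X p _ d_gt0 leKX ledX _ t
  (2 ^ (c * up_log 2 n))) => //; first by rewrite eD.
- by lia.
- split=> // u v uv; rewrite /= (inj_eq id_inj).
  by apply: contraTneq uv => ->; rewrite ei.
- apply: (@leq_trans (tower t.+1 ^ c)).
    by rewrite /= -expnM mulnC leq_exp2l // leq_mul2r up_log_min ?orbT.
  apply: (@leq_trans (tower t.+1 ^ K)); first by apply: leq_pexp2l; [apply: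
    tower_gt0|lia].
  by rewrite leq_exp2r // leq_maxl.
- apply: leq_trans leXN; rewrite leq_exp2r // geq_max leq_maxr andbT.
  by apply: leq_trans le_tower_n _; rewrite geq_max leq_maxl leq_max X0 orbT.
Qed.

Hypothesis leNw : 0 < D -> N <= 2 ^ w.

Lemma linial_solves :
  solves fresh color (c * up_log 2 n) w n D (linial_prog d K X t.+1)
    (16 * K ^ 2 * d ^ 2 * X ^ 2).
Proof.
move=> V e ports id es ei pP idP _ eD.
have [msgs prop _] := linial_from_ids es ei pP idP eD.
by split=> // D0; apply: msgs_lt_leq msgs; apply: leNw.
Qed.

End FromIdentifiers.

Section PolynomialPalette.
Variables (c d n D t w N : nat).
Local Notation K := (c + 5).
Hypothesis leDd : D <= d.
Hypothesis d_big : 16 * K ^ 2 <= d.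
Hypothesis le_n_tower : n <= tower t.+1.
Hypothesis le_tower_n : tower t <= maxn n 1.
Hypothesis leidN : 2 ^ (c * up_log 2 n) <= N.
Hypothesis ledN : maxn n d ^ K <= N.

Let d_gt0 : 0 < d. Proof. by have := d_big; nia. Qed.

(** The case [X = d], [p = 2]: the palette [16 * K ^ 2 * d ^ 4] is at most [d ^ 5]. *)
Lemma linial_polynomial (V : finType) (e : rel V) (ports : V -> seq V) (id :
  V -> nat) :
  symmetric e -> irreflexive e -> port_numbering e ports ->
  unique_ids (c * up_log 2 n) id -> max_degree e = D ->
  [/\ msgs_lt ports N (linial_prog d K d t.+1) (fresh \o id),
      proper_coloring e (d ^ K)
        (color \o exec ports (linial_prog d K d t.+1) (fresh \o id))
    & forall v, exec ports (linial_prog d K d t.+1) (fresh \o id) v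
        = fresh (color (exec ports (linial_prog d K d t.+1) (fresh \o id) v))].
Proof.
move=> es ei pP idP eD.
have lecK : c + 2 + 3 <= K by lia.
have [msgs prop fr] := linial_from_ids leDd d_gt0 d_big (leqnn _) lecK le_n_tower
  le_tower_n leidN ledN es ei pP idP eD.
split=> //; apply: proper_coloringW prop.
apply: (@leq_trans (d ^ 5)); last by apply: leq_pexp2l; rewrite //; lia.
by rewrite -mulnA -expnD (expnSr d 4) mulnC leq_mul2l d_big orbT.
Qed.

Hypothesis leNw : 0 < D -> N <= 2 ^ w.

Lemma quadratic_solves :
  exists p q, [/\ solves fresh color (c * up_log 2 n) w n D p q,
    size p = t.+2 & q <= (2 * (d * K)) ^ 2].
Proof.
have [|qlo qhi] := @pow2_between (d * K); first by lia.
set a := trunc_log 2 (d * K) in qlo qhi.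
exists (linial_prog d K d t.+1 ++ [:: linial a K]), ((2 ^ a.+1) ^ 2).
split; last 1 first.
- by rewrite leq_exp2r.
- move=> V e ports id es ei pP idP _ eD.
  have [msgs prop fr] := linial_polynomial es ei pP idP eD.
  have dq : d ^ K < (2 ^ a.+1) ^ K.
    rewrite ltn_exp2r; last by lia.
    by apply: leq_ltn_trans qlo; nia.
  have [|prop' _] := linial_step es pP prop dq.
    by apply: leq_ltn_trans qlo; rewrite eD leq_mul2r leDd orbT.
  split=> [D0|]; last by rewrite exec_cat.
  apply: (@msgs_lt_leq _ _ _ N); first exact: leNw.
  rewrite msgs_lt_cat; split=> //; split=> // v; apply: leq_trans (prop.1 v) _.
  apply: leq_trans ledN; rewrite leq_exp2r ?leq_maxr //; lia.
by rewrite size_cat size_linial_prog addn1.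
Qed.

Variables (b Q k2 k3 : nat).
Hypothesis ledb : d <= b ^ 2.
Hypothesis ledQb : d <= Q * b.
Hypothesis codable2 : d ^ K <= Q ^ k2.
Hypothesis codable3 : d ^ K <= b ^ k3.
Hypothesis trialsN : 4 * k2 * Q <= N.
Hypothesis pointsN : (4 * k3 * b) ^ 2 < N.
Hypothesis curvesN : d ^ K * (4 * k3 * b) <= N.

Lemma sublinear_solves :
  exists p q, [/\ solves fresh (odflt 0 \o final) (c * up_log 2 n) w n D p q,
    size p <= t.+1 + 12 * k2 * Q & q <= (4 * k3 * b) ^ 2].
Proof.
have /andP[Q0 b0] : (0 < Q) && (0 < b).
  by rewrite -muln_gt0; apply: leq_trans ledQb.
have dK1 : 1 < d ^ K.
  have d1 : 1 < d by have := d_big; nia.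
  by apply: (@leq_trans (d ^ 1)) => //; apply: leq_pexp2l; rewrite //; lia.
have k20 : 0 < k2 by case: (k2) codable2 => //; rewrite expn0 leqNgt dK1.
have k30 : 0 < k3 by case: (k3) codable3 => //; rewrite expn0 leqNgt dK1.
(* The factor 2 covers the two kinds of collisions in the trials: [d * (2 * k2) <= 2 * k2 * Q * b <
   q2 * b.+1]. *)
have [|q2lo q2hi] := @pow2_between (2 * k2 * Q); first by rewrite !muln_gt0 k20.
have [|q3lo q3hi] := @pow2_between (2 * k3 * b); first by rewrite !muln_gt0 k30.
set a2 := trunc_log 2 (2 * k2 * Q) in q2lo q2hi.
set a3 := trunc_log 2 (2 * k3 * b) in q3lo q3hi.
pose q2 := 2 ^ a2.+1; pose q3 := 2 ^ a3.+1.
rewrite -/q2 -/q3 in q2lo q2hi q3lo q3hi.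
exists (linial_prog d K d t.+1 ++ trial_prog a2 k2 b q2
  ++ coloring_prog a3 k3 q2), (q3 ^ 2).
have q3b : q3 <= 4 * k3 * b by lia.
split; last 1 first.
- by rewrite leq_exp2r.
- move=> V e ports id es ei pP idP _ eD.
  have [msgs1 prop fr] := linial_polynomial es ei pP idP eD.
  set s1 := exec _ _ _ in prop fr.
  have dq2 : d ^ K < q2 ^ k2.
    apply: leq_ltn_trans codable2 _; rewrite ltn_exp2r //.
    by apply: leq_ltn_trans q2lo; rewrite leq_pmull // muln_gt0 k20.
  have dq3 : d ^ K < q3 ^ k3.
    apply: leq_ltn_trans codable3 _; rewrite ltn_exp2r //.
    by apply: leq_ltn_trans q3lo; rewrite leq_pmull // muln_gt0 k30.
  have msgs2 := trial_msgs_lt ports a2 k2 b fr q2.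
  have [|y [h [s2E y_lt few orient]]] := trial_phase es pP fr prop dq2 (b := b).
    rewrite eD; apply: (@leq_ltn_trans (d * (2 * k2)));
      first by rewrite leq_mul2r leDd orbT.
    rewrite mulnC; apply: (@leq_ltn_trans (2 * k2 * (Q * b))).
      by rewrite leq_mul2l ledQb orbT.
    by rewrite mulnA; apply: ltn_mul.
  have q3_big : max_degree e + b * k3 * q3 < q3 * q3.
    by rewrite eD; apply: room_for_point leDd ledb k30 q3lo.
  have [||msgs3 prop3] :=
    coloring_phase es pP prop dq3 s2E y_lt few orient q3_big (N := N).
  - by apply: leq_ltn_trans pointsN; rewrite leq_exp2r.
  - by apply: leq_trans curvesN; rewrite leq_mul2l q3b orbT.
  split=> [D0|]; last by rewrite !exec_cat.
  apply: (@msgs_lt_leq _ _ _ N); first exact: leNw.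
  rewrite !msgs_lt_cat; do !split=> //.
  by apply: msgs_lt_leq msgs2; apply: leq_trans q2hi _; rewrite !mulnA.
(* The [q2] trials and two rounds for each of [q2] classes make [3 * q2 <= 12 * k2 * Q]. *)
- rewrite !size_cat size_linial_prog size_map size_iota size_coloring_prog; lia.
Qed.

End PolynomialPalette.

(** * Choice of the parameters *)

Local Open Scope ring_scope.

(** * Iterated logarithm and integer approximations of real powers *)

Section RealBounds.
Variable R : realType.
Implicit Types (x theta : R) (d n : nat).

Lemma le_tower_of_iter_log2 i x : iter i (@log2 R) x <= 1 -> x <= (tower i)%:R.
Proof.
elim: i x => [//|i IHi] x; rewrite iterSr => /IHi.
have ln2_gt0 : 0 < ln (2 : R) by rewrite ln_gt0 // ltr1n.
rewrite /log2 ler_pdivrMr // => lex.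
have [x0|x0] := ltP 0 x; last by apply: le_trans x0 _; rewrite ler0n.
rewrite -ler_ln ?posrE ?ltr0n ?expn_gt0 //.
by apply: le_trans lex _; rewrite /= natrX lnXn ?ltr0n // mulr_natl.
Qed.

Lemma le_tower_log_star n : (n <= tower (log_star R n))%N.
Proof.
rewrite -(ler_nat R); apply: le_tower_of_iter_log2.
by rewrite /log_star; case: ex_minnP.
Qed.

Lemma tower_lt_log_star n i : (i < log_star R n)%N -> (tower i < n)%N.
Proof.
rewrite /log_star; case: ex_minnP => j _ j_min; rewrite ltnNge; apply:
  contraNltn => le_n.
by apply: j_min; apply: iter_log2_tower; rewrite ler_nat.
Qed.

(** Prepares a first phase of [t.+1] rounds, which is [log_star R n] for [n > 1]; for [n <= 1] the
    predecessor of 0 is 0 and one round is run. *)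
Lemma log_star_pred_spec n (t := (log_star R n).-1) :
  (n <= tower t.+1)%N /\ (tower t <= maxn n 1)%N.
Proof.
have := le_tower_log_star n; have := @tower_lt_log_star n; rewrite /t.
case: (log_star R n) => [|i] /= lt_n le_n; first by split; lia.
by split=> //; have := lt_n i (ltnSn i); lia.
Qed.

Lemma log_star_gt0 n : (1 < n)%N -> (0 < log_star R n)%N.
Proof.
move=> n1; have := le_tower_log_star n.
by case: (log_star R n) => // /(leq_trans n1).
Qed.

Definition rpow theta d : nat := (Num.truncn (d%:R `^ theta)).+1.

Lemma rpow_ge theta d : d%:R `^ theta <= (rpow theta d)%:R.
Proof. by apply/ltW/truncnS_gt. Qed.

Lemma powR_ge1 x theta : 1 <= x -> 0 <= theta -> 1 <= x `^ theta.
Proof. by move=> x1 th; rewrite -(powRr0 x); apply: ler_powR. Qed.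

Lemma rpow_le theta d : 0 <= theta -> (0 < d)%N ->
  (rpow theta d)%:R <= 2 * d%:R `^ theta.
Proof.
move=> th d0; rewrite /rpow -addn1 natrD.
have := @powR_ge1 d%:R theta; rewrite ler1n => /(_ d0 th).
have /andP[] := truncn_itv (powR_ge0 d%:R theta); lra.
Qed.

Lemma rpow_le_expn theta d E : 0 <= theta -> theta <= E%:R -> (0 < d)%N ->
  (rpow theta d <= 2 * d ^ E)%N.
Proof.
move=> th thE d0; rewrite -(ler_nat R); apply: le_trans (rpow_le th d0) _.
rewrite natrM ler_pM2l // natrX -powR_mulrn ?ler0n //.
by apply: ler_powR; rewrite ?ler1n.
Qed.

Lemma expn_le_rpow theta d j p :
  0 <= theta -> j%:R <= theta * p%:R -> (0 < d)%N ->
  (d ^ j <= rpow theta d ^ p)%N.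
Proof.
move=> th jp d0; rewrite -(ler_nat R) !natrX.
apply: (@le_trans _ _ ((d%:R `^ theta) ^+ p)); last first.
  by apply: lerXn2r; rewrite ?nnegrE ?powR_ge0 ?ler0n ?rpow_ge.
rewrite -!powR_mulrn ?powR_ge0 ?ler0n // -powRrM.
by apply: ler_powR; rewrite ?ler1n.
Qed.

Lemma powR_maxn_le theta d D C : 0 <= theta -> (d <= C * maxn 1 D)%N ->
  d%:R `^ theta <= C%:R `^ theta * (maxn 1 D)%:R `^ theta.
Proof.
move=> th le_d; rewrite -powRM ?ler0n // -natrM.
by apply: ge0_ler_powR; rewrite ?nnegrE ?ler0n ?ler_nat.
Qed.

End RealBounds.

(** * Logarithmic message length *)

Section MessageBounds.
Local Open Scope nat_scope.
Variables (c P D0 n D : nat).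
Hypothesis D0_gt0 : 0 < D0.
Hypothesis leDn : D <= n.-1.
Local Notation u := (up_log 2 n).

Definition message_bound : nat := maxn (2 ^ (c * u)) ((n.+1 * D0) ^ P).

Definition message_factor : nat := c + P * (2 + up_log 2 D0).

(** An edge forces [n > 1], so [u] is positive and absorbs the constant [D0], while
    [n.+1 <= 2 * n <= 2 ^ (2 * u)]. *)
Lemma message_bound_le : 0 < D -> message_bound <= 2 ^ (message_factor * u).
Proof.
move=> Dp; have n1 : 1 < n by lia.
have u1 : 0 < u by rewrite up_log_gt0.
rewrite /message_bound /message_factor geq_max leq_exp2l //
  leq_mul2r leq_addr orbT /=.
apply: (@leq_trans (2 ^ ((2 + up_log 2 D0) * u * P))); last first.
  by rewrite leq_exp2l //; nia.
rewrite expnM; have [->|P0] := posnP P; first by rewrite !expn0.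
rewrite leq_exp2r // mulnDl expnD; apply: leq_mul.
  apply: (@leq_trans (2 * n)); first by lia.
  rewrite [2 * u]mul2n -addnn expnD; apply: leq_mul; last exact: up_logP.
  by rewrite -{1}(expn1 2) leq_exp2l.
apply: leq_trans (up_logP D0 (isT : 1 < 2)) _.
by rewrite leq_exp2l // leq_pmulr.
Qed.

Lemma expn_le_message_bound d j :
  d <= n.+1 * D0 -> j <= P -> d ^ j <= message_bound.
Proof.
move=> le_d jP; rewrite leq_max; apply/orP; right.
apply: (@leq_trans ((n.+1 * D0) ^ j)); last by apply: leq_pexp2l;
  rewrite ?muln_gt0.
by have [->|j0] := posnP j; rewrite ?expn0 // leq_exp2r.
Qed.

Lemma maxn_le_scaled : maxn D D0 <= n.+1 * D0.
Proof. by rewrite geq_max; apply/andP; split; nia. Qed.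

End MessageBounds.

(** * The three ranges of [eps] *)

Section Tradeoff.
Variables (R : realType) (eps : R) (c : nat).

Definition tradeoff (Cr Cc : R) (n D T q : nat) : Prop :=
  q%:R <= Cc * (maxn 1 D)%:R `^ (1 + eps) /\
  T%:R <= Cr * (maxn 1 D)%:R `^ (1 / 2 - eps / 2) + (log_star R n)%:R.

Definition tradeoff_solvable : Prop :=
  exists (out : node -> nat) (Cr Cc : R) (Cm : nat),
  forall n D, (D <= n.-1)%N -> exists p q,
    solves fresh out (c * up_log 2 n) (Cm * up_log 2 n) n D p q
    /\ tradeoff Cr Cc n D (size p) q.

Lemma maxn_le_scaled1 D D0 : (0 < D0)%N -> (maxn D D0 <= D0 * maxn 1 D)%N.
Proof. by move=> D00; rewrite geq_max; apply/andP; split; nia. Qed.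

Lemma natr_maxn_ge1 (D : nat) : 1 <= (maxn 1 D)%:R :> R.
Proof. by rewrite ler1n leq_maxl. Qed.

Lemma truncn_div_lt (x y : R) : 0 < y -> x <= y * (Num.truncn (x / y)).+1%:R.
Proof. by move=> y0; rewrite mulrC -ler_pdivrMr //; apply/ltW/truncnS_gt. Qed.

Lemma superquadratic : 1 < eps -> tradeoff_solvable.
Proof.
(* With [X] about [d ^ theta], the palette of order [d ^ 2 * X ^ 2] has order [d ^ (1 + eps)]. *)
move=> eps1; set theta := (eps - 1) / 2.
have th : 0 < theta by rewrite /theta; lra.
set p := (Num.truncn (2 / theta)).+1.
have thp : 2 <= theta * p%:R by apply: truncn_div_lt.
(* As [X ^ p >= d >= D0], this value of [D0] forces [16 * K ^ 2 <= X]. *)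
set K := (c + p + 3)%N; set D0 := ((16 * K ^ 2) ^ p)%N.
have K0 : (0 < K)%N by rewrite /K addn3.
set E := (Num.truncn theta).+1.
have thE : theta <= E%:R by apply/ltW/truncnS_gt.
set P := ((E + 2) * K)%N.
have D02 : (2 <= D0)%N.
  by apply: (@leq_trans (2 ^ p));
    [rewrite -{1}(expn1 2) leq_exp2l | rewrite leq_exp2r //; nia].
exists color, 1, (64 * K%:R ^+ 2 * D0%:R `^ (1 + eps)),
  (message_factor c P D0) => n D leDn.
set d := maxn D D0; set X := rpow theta d.
have [le_n le_t] := log_star_pred_spec R n.
have d2 : (2 <= d)%N by rewrite leq_max D02 orbT.
have d0 : (0 < d)%N by apply: ltnW.
have KX : (16 * K ^ 2 <= X)%N.
  rewrite -(@leq_exp2r _ _ p) //; apply: (@leq_trans (d ^ 1)).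
    by rewrite expn1 /d leq_maxr.
  apply: expn_le_rpow => //; [exact: ltW|lra].
have dX : (d ^ 2 <= X ^ p)%N by apply: expn_le_rpow => //; apply: ltW.
have dD0 : (d <= n.+1 * D0)%N by apply: maxn_le_scaled; rewrite // ltnW.
have XN : (maxn n X ^ K <= message_bound c P D0 n)%N.
  apply: (@leq_trans ((maxn n d ^ (E + 2)) ^ K)); last first.
    rewrite -expnM; apply: expn_le_message_bound; rewrite ?(ltnW D02) //.
    by rewrite geq_max dD0 andbT; nia.
  rewrite leq_exp2r // geq_max; apply/andP; split.
    apply: (@leq_trans (maxn n d ^ 1)); first by rewrite expn1 leq_maxl.
    by apply: leq_pexp2l; rewrite ?addn2 // leq_max d0 orbT.
  apply: leq_trans (rpow_le_expn (ltW th) thE d0) _.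
  apply: (@leq_trans (d ^ E.+1)); first by rewrite expnS leq_mul2r d2 orbT.
  apply: (@leq_trans (maxn n d ^ E.+1)); first by rewrite leq_exp2r // leq_maxr.
  by apply: leq_pexp2l; rewrite ?addn2 // leq_max d0 orbT.
exists (linial_prog d K X (log_star R n).-1.+1), (16 * K ^ 2 * d ^ 2 * X ^ 2)%N.
split.
  apply: (@linial_solves c K p d X n D _ _ (message_bound c P D0 n)) => //.
  - by rewrite /d leq_maxl.
  - by rewrite leq_maxl.
  - exact: message_bound_le (ltnW D02) leDn.
split.
  apply: (@le_trans _ _ (64 * K%:R ^+ 2 * d%:R `^ (1 + eps))).
    have -> : d%:R `^ (1 + eps) = d%:R ^+ 2 * (d%:R `^ theta) ^+ 2 :> R.
      rewrite -!powR_mulrn ?ler0n ?powR_ge0 //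
        -powRrM -powRD ?pnatr_eq0 ?gtn_eqF ?d0 ?implybT //.
      by congr (_ `^ _); rewrite /theta; lra.
    have -> : (16 * K ^ 2 * d ^ 2 * X ^ 2)%:R
        = 16 * K%:R ^+ 2 * d%:R ^+ 2 * X%:R ^+ 2 :> R by rewrite !natrM; ring.
    have XX : X%:R ^+ 2 <= (2 * d%:R `^ theta) ^+ 2 :> R.
      by apply: lerXn2r; rewrite ?nnegrE ?ler0n ?mulr_ge0 ?powR_ge0 //
        rpow_le // ltW.
    apply: (le_trans (ler_wpM2l _ XX)); first by rewrite !mulr_ge0 ?exprn_ge0.
    by rewrite le_eqVlt; apply/orP; left; apply/eqP; ring.
  rewrite -[leRHS]mulrA ler_wpM2l ?mulr_ge0 ?exprn_ge0 //.
  by apply: powR_maxn_le; [lra|apply: maxn_le_scaled1; apply: ltnW].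
(* The degree has a negative exponent here, so no additive constant can be hidden. For [D = 0] the
   power is 1 and pays for a possible extra round; for [D > 0] exactly [log_star R n] rounds are
   run. *)
rewrite size_linial_prog; case: (posnP D) => [->|Dp].
  by rewrite maxn0 powR1 mulr1 -[1]/(1%:R) -natrD ler_nat; lia.
have := log_star_gt0 R (n := n); rewrite (_ : (1 < n)%N); last by lia.
by move=> /(_ isT) /prednK ->; rewrite lerDr mul1r powR_ge0.
Qed.

Lemma quadratic : eps = 1 -> tradeoff_solvable.
Proof.
move=> eps1; set K := (c + 5)%N; set D0 := (16 * K ^ 2)%N.
have D00 : (0 < D0)%N by rewrite /D0 /K; nia.
exists color, 2, (4 * K%:R ^+ 2 * D0%:R `^ 2), (message_factor c K D0) =>
  n D leDn.
set d := maxn D D0.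
have [le_n le_t] := log_star_pred_spec R n.
have dD0 : (d <= n.+1 * D0)%N by apply: maxn_le_scaled.
have [|||||p [q [sol szp le_q]]] := @quadratic_solves c d n D _
  (message_factor c K D0 * up_log 2 n) (message_bound c K D0 n) _ _ le_n le_t.
- by rewrite /d leq_maxl.
- by rewrite /d leq_maxr.
- by rewrite leq_maxl.
- by apply: expn_le_message_bound; rewrite // geq_max dD0 andbT; nia.
- exact: message_bound_le D00 leDn.
exists p, q; split=> //; split; last first.
  rewrite szp eps1 subrr powRr0 mulr1 -natrD ler_nat; lia.
apply: (@le_trans _ _ (4 * K%:R ^+ 2 * d%:R `^ 2)).
  rewrite powR_mulrn ?ler0n // -!natrX -!natrM ler_nat; apply: leq_trans le_q _.
  by rewrite -/K !expnMn; lia.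
rewrite -[leRHS]mulrA ler_wpM2l ?mulr_ge0 ?exprn_ge0 //.
by rewrite eps1 -[1 + 1]/2; apply: powR_maxn_le; [lra|apply: maxn_le_scaled1].
Qed.

Lemma subquadratic : 0 < eps -> eps < 1 -> tradeoff_solvable.
Proof.
(* [Q] and [b] will be about [d ^ theta] and [d ^ alpha]: [theta + alpha = 1] gives [d <= Q * b],
   and [alpha >= 1 / 2] gives [d <= b ^ 2] and lets [k3 = 2 * K] suffice. *)
move=> eps0 eps1; set theta := 1 / 2 - eps / 2; set alpha := (1 + eps) / 2.
have th : 0 < theta by rewrite /theta; lra.
have al : 0 < alpha by rewrite /alpha; lra.
set K := (c + 5)%N; set k2 := (Num.truncn (K%:R / theta)).+1; set k3 := (2 * K)%N.
have thk : K%:R <= theta * k2%:R by apply: truncn_div_lt.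
(* The last two terms bound [4 * k2 * Q] and [4 * k3 * b] by [d ^ 2], so every message bound is a
   power of [d] with exponent at most [P]. *)
set D0 := (16 * K ^ 2 + 8 * k2 + 8 * k3)%N.
have D00 : (0 < D0)%N by rewrite /D0; lia.
set P := (K + 5)%N.
exists (odflt 0%N \o final), (1 + 24 * k2%:R * D0%:R `^ theta),
  (64 * k3%:R ^+ 2 * D0%:R `^ (1 + eps)), (message_factor c P D0) => n D leDn.
set d := maxn D D0; set Q := rpow theta d; set b := rpow alpha d.
have [le_n le_t] := log_star_pred_spec R n.
have dD0 : (d <= n.+1 * D0)%N by apply: maxn_le_scaled.
have D0d : (D0 <= d)%N by rewrite /d leq_maxr.
have d0 : (0 < d)%N by apply: leq_trans D0d.
have k2d : (8 * k2 <= d)%N by apply: leq_trans D0d; rewrite /D0; lia.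
have k3d : (8 * k3 <= d)%N by apply: leq_trans D0d; rewrite /D0; lia.
have Q2d : (Q <= 2 * d)%N.
  by rewrite -[X in (2 * X)%N](expn1 d); apply: rpow_le_expn => //;
    rewrite /theta; lra.
have b2d : (b <= 2 * d)%N.
  by rewrite -[X in (2 * X)%N](expn1 d); apply: rpow_le_expn => //;
    rewrite /alpha; lra.
have ledN j : (j <= P)%N -> (d ^ j <= message_bound c P D0 n)%N.
  exact: expn_le_message_bound.
have k2Q : (4 * k2 * Q <= d ^ 2)%N by nia.
have k3b : (4 * k3 * b <= d ^ 2)%N by nia.
have [||||||||||||p [q [sol szp le_q]]] := @sublinear_solves c d n D _
  (message_factor c P D0 * up_log 2 n) (message_bound c P D0 n) _ _ le_n le_t
  _ _ _ b Q k2 k3.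
- by rewrite /d leq_maxl.
- by apply: leq_trans D0d; rewrite /D0; lia.
- by rewrite leq_maxl.
- have nD0 : (n <= n.+1 * D0)%N by apply: leq_trans (leqnSn n) (leq_pmulr _ D00).
  have ndD0 : (maxn n d <= n.+1 * D0)%N by rewrite (geq_max _ n d) nD0 dD0.
  by apply: expn_le_message_bound => //; apply: leq_addr.
- exact: message_bound_le D00 leDn.
- by rewrite -{1}(expn1 d); apply: expn_le_rpow => //; rewrite /alpha; lra.
- rewrite -(ler_nat R) natrM.
  apply: (@le_trans _ _ (d%:R `^ theta * d%:R `^ alpha)).
    rewrite -powRD ?pnatr_eq0 ?gtn_eqF ?d0 ?implybT //.
    by rewrite (_ : theta + alpha = 1) ?powRr1 ?ler0n // /theta /alpha; lra.
  by apply: ler_pM; rewrite ?powR_ge0 ?rpow_ge.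
- by apply: expn_le_rpow => //; apply: ltW.
- apply: expn_le_rpow => //; first exact: ltW.
  have -> : alpha * k3%:R = K%:R + eps * K%:R by rewrite /alpha /k3 natrM; field.
  by rewrite lerDl mulr_ge0 // ltW.
- by apply: leq_trans k2Q (ledN 2 _); rewrite /P; lia.
- apply: (@leq_ltn_trans (d ^ 4)); first by rewrite (expnM d 2 2) leq_exp2r.
  apply: (@leq_trans (d ^ 5)); last by apply: ledN; rewrite /P; lia.
  by rewrite ltn_exp2l //; lia.
- apply: (@leq_trans (d ^ (K + 2)));
  first by rewrite (expnD d K 2) leq_mul2l k3b orbT.
  by apply: ledN; rewrite /P; lia.
exists p, q; split=> //; split.
  apply: (@le_trans _ _ (64 * k3%:R ^+ 2 * d%:R `^ (1 + eps))).
    have -> : d%:R `^ (1 + eps) = (d%:R `^ alpha) ^+ 2 :> R.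
      rewrite -powR_mulrn ?powR_ge0 // -powRrM.
      by congr (_ `^ _); rewrite /alpha; lra.
    have le_qR :
      q%:R <= (4 * k3%:R * b%:R) ^+ 2 :> R by rewrite -!natrM -natrX ler_nat.
    have bb : (4 * k3%:R * b%:R) ^+ 2 <= (4 * k3%:R * (2 * d%:R `^ alpha)) ^+ 2 :> R.
      apply: lerXn2r; rewrite ?nnegrE ?mulr_ge0 ?ler0n ?powR_ge0 //.
      by rewrite ler_wpM2l ?mulr_ge0 ?ler0n // rpow_le // ltW.
    apply: (le_trans le_qR); apply: (le_trans bb).
    by rewrite le_eqVlt; apply/orP; left; apply/eqP; ring.
  rewrite -[leRHS]mulrA ler_wpM2l ?mulr_ge0 ?exprn_ge0 //.
  by apply: powR_maxn_le; [lra|apply: maxn_le_scaled1].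
set m := (maxn 1 D)%:R `^ theta.
have m1 : 1 <= m by apply: powR_ge1; rewrite ?natr_maxn_ge1 ?ltW.
have dm : d%:R `^ theta <= D0%:R `^ theta * m.
  by apply: powR_maxn_le; [apply: ltW|apply: maxn_le_scaled1].
have Qm : Q%:R <= 2 * (D0%:R `^ theta * m).
  by apply: le_trans (rpow_le (ltW th) d0) _; rewrite ler_pM2l.
(* The extra 1 covers [n <= 1] and is absorbed because [m >= 1]. *)
apply: (@le_trans _ _ ((1 + log_star R n)%:R + 12 * k2%:R * Q%:R)).
  by rewrite -!natrM -natrD ler_nat; lia.
have kQ : 12 * k2%:R * Q%:R <= 12 * k2%:R * (2 * (D0%:R `^ theta * m)).
  by rewrite ler_wpM2l // mulr_ge0 ?ler0n.
rewrite natrD; lra.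
Qed.

End Tradeoff.

Theorem theorem3 (R : realType) (eps : R) (c : nat) :
  0 < eps ->
  exists (A : algorithm) (rounds colors : nat -> nat -> nat)
         (Cr Cc : R) (Cm : nat),
  forall (V : finType) (e : rel V) (ports : V -> seq V) (id : V -> nat),
    symmetric e -> irreflexive e ->
    port_numbering e ports ->
    unique_ids (c * up_log 2 #|V|)%N id ->
    let n := #|V| in
    let D := max_degree e in
    let T := rounds n D in
    let q := colors n D in
    [/\ bandwidth_le A e ports id T (Cm * up_log 2 n)%N,
        proper_coloring e q (coloring_after A e ports id T),
        q%:R <= Cc * (maxn 1 D)%:R `^ (1 + eps)
      & T%:R <= Cr * (maxn 1 D)%:R `^ (1 / 2 - eps / 2)
                + (log_star R n)%:R].
Proof.
move=> eps0; have [out [Cr [Cc [Cm H]]]] : tradeoff_solvable eps c.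
  have [eps1|eps1|eps1] := ltgtP eps 1.
  - exact: subquadratic.
  - exact: superquadratic.
  - exact: quadratic.
have [A [rounds [colors sol]]] := algorithm_of_programs H.
exists A, rounds, colors, Cr, Cc, Cm => V e ports id es ei pP idP n D T q.
by have [? ? []] := sol V e ports id es ei pP idP.
Qed.
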